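(* For any bipartite graph $G$, we have the inequalities $$\tfrac14\,\mathrm{las}_{\mathrm{bal},1}(G)\ \le\ \tfrac12\sqrt{g_{\mathrm{bal},1}(G)}\ \le\ h_{\mathrm{bal},1}(G)\ =\ \tfrac14\,\vartheta_{\mathrm{bal}}(G).$$ Moreover, we have $\tfrac12\sqrt{g_{\mathrm{bal},1}(G)}=\tfrac14\vartheta_{\mathrm{bal}}(G)$ if and only if $\mathrm{las}_{\mathrm{bal},1}(G)=\vartheta_{\mathrm{bal}}(G)$.
   Context: $G=(V=V_1\cup V_2,E)$ is a bipartite graph with given bipartition. $\mathcal S^{|V|}$ is the set of real symmetric matrices indexed by $V$; $\langle X,Y\rangle=\mathrm{Tr}(XY)$; $I$ and $J$ are the identity and the all-ones matrix of size $|V|$; $\mathrm{diag}(X)$ is the vector of diagonal entries of $X$; $\mathrm{Diag}(x)$ is the diagonal matrix with diagonal $x$. Let $f=\chi^{V_1}-\chi^{V_2}\in\mathbb R^{V}$ (value $1$ on $V_1$, $-1$ on $V_2$), and let $C\in\mathcal S^{|V|}$ have entries $\frac12$ at positions $(i,j)$ with $i,j$ on different sides of the bipartition, and $0$ elsewhere. The four parameters are the optimal values of the following semidefinite programs over $X\in\mathcal S^{|V|}$ (semidefinite relaxations of parameters dealing with balanced independent sets in $G$): $$\mathrm{las}_{\mathrm{bal},1}(G)=\max\Big\{\langle I,X\rangle:\begin{pmatrix}1&\mathrm{diag}(X)^T\\ \mathrm{diag}(X)&X\end{pmatrix}\succeq0,\ X_{ij}=0\text{ if }\{i,j\}\in E,\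 \langle ff^T,X\rangle=0\Big\},$$ $$g_{\mathrm{bal},1}(G)=\max\Big\{\langle C,X\rangle:\begin{pmatrix}1&\mathrm{diag}(X)^T\\ \mathrm{diag}(X)&X\end{pmatrix}\succeq0,\ X_{ij}=0\text{ if }\{i,j\}\in E,\ \langle ff^T,X\rangle=0\Big\},$$ $$h_{\mathrm{bal},1}(G)=\max\{\langle C,X\rangle: X\succeq0,\ \mathrm{Tr}(X)=1,\ X_{ij}=0\text{ if }\{i,j\}\in E,\ \langle ff^T,X\rangle=0,\ \langle\mathrm{Diag}(f),X\rangle=0\},$$ $$\vartheta_{\mathrm{bal}}(G)=\max\{\langle J,X\rangle: X\succeq0,\ \mathrm{Tr}(X)=1,\ X_{ij}=0\text{ if }\{i,j\}\in E,\ \langle ff^T,X\rangle=0,\ \langle\mathrm{Diag}(f),X\rangle=0\}.$$ *)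

(* Defs.v *)
From HB Require Import structures.
From mathcomp Require Import all_boot all_order all_algebra.
From mathcomp Require Import boolp classical_sets reals.

Set Implicit Arguments.
Unset Strict Implicit.
Unset Printing Implicit Defensive.

Import Order.TTheory GRing.Theory Num.Theory.

Local Open Scope classical_set_scope.
Local Open Scope ring_scope.

Definition is_bipartite (V : finType) (V1 V2 : {set V}) (E : rel V) : Prop :=
  [/\ (V1 :|: V2 = [set: V])%SET,
      (V1 :&: V2)%SET = finset.set0,
      symmetric E &
      forall x y, E x y -> (x \in V1) && (y \in V2) || (x \in V2) && (y \in V1)].

Section Programs.
Variable R : realType.

(* The greatest element of S.  A program without optimal solution gets value 0;
   this matters only for the programs h_bal1 and theta_bal, whose feasible
   region may be empty (e.g. when one side of G is empty, or when
   G is a star), and the value is then 0 = las_bal1 = g_bal1. *)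
Definition maximum (S : set R) : R := xget 0 [set m | S m /\ ubound S m].

Definition maximize (n : nat) (obj : 'M[R]_n -> R) (feas : set 'M[R]_n) : R :=
  maximum [set obj X | X in feas].

Definition mxdot (n : nat) (X Y : 'M[R]_n) : R := \tr (X *m Y).

Definition psd (n : nat) (X : 'M[R]_n) : Prop :=
  X^T = X /\ forall x : 'cV[R]_n, 0 <= (x^T *m X *m x) ord0 ord0.

Definition diagv (n : nat) (X : 'M[R]_n) : 'cV[R]_n := \col_i X i i.

Definition bordered (n : nat) (X : 'M[R]_n) : 'M[R]_(1 + n) :=
  block_mx 1%:M (diagv X)^T (diagv X) X.

Section Graph.
(* Rows and columns of a matrix indexed by V are numbered by enum_rank. *)
Variables (V : finType) (V1 V2 : {set V}) (E : rel V).

Definition edge_zero (X : 'M[R]_#|V|) : Prop :=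
  forall x y : V, E x y -> X (enum_rank x) (enum_rank y) = 0.

Definition fvec : 'cV[R]_#|V| :=
  \col_i ((enum_val i \in V1)%:R - (enum_val i \in V2)%:R).

Definition Cmx : 'M[R]_#|V| :=
  \matrix_(i, j)
    (let x := enum_val i in let y := enum_val j in
     if (x \in V1) && (y \in V2) || (x \in V2) && (y \in V1) then 2^-1 else 0).

Definition bordered_feasible : set 'M[R]_#|V| :=
  [set X | [/\ X^T = X, psd (bordered X), edge_zero X &
               mxdot (fvec *m fvec^T) X = 0]].

Definition trace_feasible : set 'M[R]_#|V| :=
  [set X | [/\ psd X, \tr X = 1, edge_zero X,
               mxdot (fvec *m fvec^T) X = 0 &
               mxdot (diag_mx fvec^T) X = 0]].

Definition las_bal1 : R := maximize (mxdot 1%:M) bordered_feasible.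
Definition g_bal1 : R := maximize (mxdot Cmx) bordered_feasible.
Definition h_bal1 : R := maximize (mxdot Cmx) trace_feasible.
Definition theta_bal : R := maximize (mxdot (const_mx 1)) trace_feasible.

End Graph.
End Programs.

(* Main.v *)
Require Import Defs.
From mathcomp Require Import all_boot all_order all_algebra.
From mathcomp Require Import boolp classical_sets reals.
From mathcomp Require Import topology normedtype derive.
From mathcomp Require Import ring lra.

Set Implicit Arguments.
Unset Strict Implicit.
Unset Printing Implicit Defensive.
Import Order.TTheory GRing.Theory Num.Theory.
Import numFieldNormedType.Exports.
Local Open Scope ring_scope.
Local Open Scope classical_set_scope.

(** Write f for the signed indicator of the bipartition, J for the all-ones
    matrix and d for the diagonal of X.

    Everything rests on two observations. The first is the identity
    C = (J - f f^T) / 4: since all four programs impose <f f^T, X> = 0, the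
    objectives <C, X> and <J, X> / 4 agree on their feasible regions
    ([mxdot_Cmx]), which already gives h = theta / 4. The second is the Schur
    complement inequality (d^T y)^2 <= y^T X y for X feasible in the bordered
    programs ([bordered_schur]). With y the all-ones vector it reads
    (Tr X)^2 <= <J, X> = 4 <C, X> <= 4 g, so that Tr X <= 2 sqrt g; applied to a
    maximiser of the trace this is las <= 2 sqrt g. With y = f it gives
    d^T f = 0, hence X / Tr X is feasible for theta as soon as Tr X > 0
    ([bordered_normalize]).

    Let Y be a maximiser for g. Normalising it gives 4 g <= theta * Tr Y, and
    Tr Y <= 2 sqrt g then yields 2 sqrt g <= theta. If moreover
    2 sqrt g = theta, the same inequality forces Tr Y >= 2 sqrt g, so that
    las >= Tr Y >= theta; together with las <= 2 sqrt g <= theta this is the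
    equality case.

    The argument uses maximisers, so the programs must be shown to attain their
    values. Their feasible regions are closed, and bounded because no entry of
    a positive semidefinite matrix exceeds, in absolute value, its largest
    diagonal entry, which is at most 1 under either kind of constraint. The
    region of the bordered programs contains 0; that of h and theta may be
    empty, in which case both values are 0. *)

(** * Attainment of maxima over compact sets of matrices *)

Lemma maximize_eq (R : realType) n (obj : 'M[R]_n -> R) (A : set 'M[R]_n) X :
  A X -> (forall Y, A Y -> obj Y <= obj X) -> maximize obj A = obj X.
Proof.
move=> AX maxX; rewrite /maximize /maximum.
apply: xget_unique => [|m [[Y AY <-] /(_ (obj X)) leXY]].
  by split=> [|_ [Y AY <-]]; [exists X | apply: maxX].
by apply/eqP; rewrite eq_le maxX// leXY//; exists X.
Qed.

Lemma maximize_set0 (R : realType) n (obj : 'M[R]_n -> R) :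
  maximize obj set0 = 0.
Proof. by apply: xgetPN => m [[X []]]. Qed.

(** Lets compactness of boxes of row vectors pass to boxes of matrices. *)
Lemma vec_mx_continuous (R : realType) m n :
  continuous (vec_mx : 'rV[R]_(m * n) -> 'M[R]_(m, n)).
Proof.
move=> v; have FF := nbhs_filter v; apply/(@cvg_ballP _ _ _ _ FF) => e e0.
near=> w; split=> // i j.
rewrite !mxE.
by have [_] : ball v e w by near: w; exact: nbhsx_ballx.
Unshelve. all: by end_near. Qed.

Lemma closed_mx_compact (R : realType) m n (A : set 'M[R]_(m, n)) (M : R) :
  closed A -> (forall X, A X -> forall i j, `|X i j| <= M) -> compact A.
Proof.
move=> clA boundA.
pose box := [set v : 'rV[R]_(m * n) | forall k, `[- M, M]%classic (v ord0 k)].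
have cbox : compact box.
  by apply: (@rV_compact _ _ (fun=> `[- M, M]%classic)) => _;
    exact: segment_compact.
apply: subclosed_compact clA (continuous_compact _ cbox) _.
  by apply: continuous_subspaceT; exact: vec_mx_continuous.
move=> X AX; exists (mxvec X); last exact: mxvecK.
move=> k; case/mxvec_indexP: k => i j.
by rewrite /= mxvecE in_itv/= -ler_norml boundA.
Qed.

Lemma maximize_attained (R : realType) n (obj : 'M[R]_n -> R)
    (A : set 'M[R]_n) (M : R) :
    continuous obj -> closed A ->
    (forall X, A X -> forall i j, `|X i j| <= M) -> A !=set0 ->
  exists2 X, A X & maximize obj A = obj X /\ forall Y, A Y -> obj Y <= obj X.
Proof.
move=> cobj clA boundA A0.
have [X /set_mem AX maxX] := compact_EVT_max A0 (closed_mx_compact clA boundA)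
  (continuous_subspaceT cobj).
have {}maxX Y : A Y -> obj Y <= obj X by move=> AY; apply/maxX/mem_set.
by exists X => //; split=> //; exact: maximize_eq.
Qed.

Lemma sum_continuous (R : realType) (T : topologicalType) (I : finType)
    (F : I -> T -> R) :
  (forall i, continuous (F i)) -> continuous (fun x => \sum_i F i x).
Proof.
move=> cF; apply: (@continuous_big R I +%R 0 xpredT _ T) => [|i _].
  exact: add_continuous.
exact: cF.
Qed.

Lemma mxdot_continuous (R : realType) n (C : 'M[R]_n) : continuous (mxdot C).
Proof.
apply: sum_continuous => i.
have -> : (fun X : 'M[R]_n => (C *m X) i i) = (fun X => \sum_j C i j * X j i).
  by apply/funext => X; rewrite mxE.
apply: sum_continuous => j X.
apply: continuousM; [exact: cst_continuous | exact: coord_continuous].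
Qed.

(** * Closedness of semidefinite constraints *)

Definition qform (R : realType) n (X : 'M[R]_n) (y : 'cV[R]_n) : R :=
  (y^T *m X *m y) ord0 ord0.

Lemma closed_preimage_eq (R : realType) (T : topologicalType) (f g : T -> R) :
  continuous f -> continuous g -> closed [set x | f x = g x].
Proof.
move=> cf cg.
have -> : [set x | f x = g x] = (fun x => f x - g x) @^-1` [set r | r = 0].
  by apply/seteqP; split=> x /= => [->|/eqP]; rewrite ?subrr// subr_eq0 => /eqP.
apply: closed_comp => [x _|]; last exact: closed_eq.
by apply: cvgB; [exact: cf | exact: cg].
Qed.

Lemma closed_forall (T : topologicalType) (I : Type) (P : I -> set T) :
  (forall i, closed (P i)) -> closed [set x | forall i, P i x].
Proof.
move=> clP; have -> : [set x | forall i, P i x] = \bigcap_i P i.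
  by apply/seteqP; split=> [x Px i _|x Px i]; apply: Px.
by apply: closed_bigI => i _.
Qed.

(** Here and in [psd_closed] the matrix depends on a parameter x through its
    entries, so that the statements cover both X and its bordered matrix, the
    latter having entries that are constant or entries of X. *)
Lemma qform_continuous (R : realType) (T : topologicalType) n
    (F : T -> 'M[R]_n) y :
  (forall i j, continuous (fun x => F x i j)) ->
  continuous (fun x => qform (F x) y).
Proof.
move=> cF.
have -> : (fun x => qform (F x) y) =
    (fun x => \sum_j (\sum_i y i ord0 * F x i j) * y j ord0).
  apply/funext => x; rewrite /qform mxE; apply: eq_bigr => j _.
  by rewrite mxE; congr (_ * _); apply: eq_bigr => i _; rewrite mxE.
apply: sum_continuous => j x; apply: continuousM; last exact: cst_continuous.
apply: sum_continuous => i {}x; apply: continuousM; first exact: cst_continuous.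
exact: cF.
Qed.

Lemma psd_closed (R : realType) (T : topologicalType) n (F : T -> 'M[R]_n) :
  (forall i j, continuous (fun x => F x i j)) -> closed [set x | psd (F x)].
Proof.
move=> cF; have -> : [set x | psd (F x)] =
    [set x | forall ij, F x ij.2 ij.1 = F x ij.1 ij.2] `&`
    [set x | forall y, 0 <= qform (F x) y].
  apply/seteqP; split=> x /= [symF posF]; split=> //.
    by move=> ij; rewrite -[in RHS]symF mxE.
  by apply/matrixP => i j; rewrite mxE (symF (i, j)).
apply: closedI; first apply: closed_forall => ij.
  by apply: closed_preimage_eq; exact: cF.
apply: closed_forall => y.
apply: (@closed_comp _ _ (fun x => qform (F x) y) [set r | 0 <= r]).
  by move=> x _; apply: qform_continuous.
exact: closed_ge.
Qed.

Lemma bordered_continuous (R : realType) n i j :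
  continuous (fun X : 'M[R]_n => bordered X i j).
Proof.
rewrite /bordered -(splitK i) -(splitK j).
case: (split i) => a; case: (split j) => b /=.
- have -> : (fun X => block_mx 1%:M (diagv X)^T (diagv X) X (lshift n a)
      (lshift n b)) = (fun=> (1%:M : 'M[R]_1) a b).
    by apply/funext => X; rewrite block_mxEul.
  exact: cst_continuous.
- have -> : (fun X => block_mx 1%:M (diagv X)^T (diagv X) X (lshift n a)
      (rshift 1 b)) = (fun X : 'M[R]_n => X b b).
    by apply/funext => X; rewrite block_mxEur !mxE.
  exact: coord_continuous.
- have -> : (fun X => block_mx 1%:M (diagv X)^T (diagv X) X (rshift 1 a)
      (lshift n b)) = (fun X : 'M[R]_n => X a a).
    by apply/funext => X; rewrite block_mxEdl !mxE.
  exact: coord_continuous.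
- have -> : (fun X => block_mx 1%:M (diagv X)^T (diagv X) X (rshift 1 a)
      (rshift 1 b)) = (fun X : 'M[R]_n => X a b).
    by apply/funext => X; rewrite block_mxEdr.
  exact: coord_continuous.
Qed.

(** * Positive semidefinite matrices *)

Lemma bilinear_delta (R : realType) n (X : 'M[R]_n) i j :
  ((delta_mx i ord0)^T *m X *m delta_mx j ord0 : 'M_1) ord0 ord0 = X i j.
Proof. by rewrite trmx_delta -rowE -colE !mxE. Qed.

Lemma mxdot_rank1 (R : realType) n (u : 'cV[R]_n) X :
  mxdot (u *m u^T) X = qform X u.
Proof.
by rewrite /mxdot /qform -mulmxA mxtrace_mulC /mxtrace big_ord1.
Qed.

Lemma const_mx1_rank1 (R : realType) n :
  const_mx 1 = (const_mx 1 : 'cV[R]_n) *m (const_mx 1 : 'cV[R]_n)^T.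
Proof. by apply/matrixP => i j; rewrite !mxE big_ord1 !mxE mulr1. Qed.

Lemma psd_diag_ge0 (R : realType) n (X : 'M[R]_n) i : psd X -> 0 <= X i i.
Proof. by case=> _ /(_ (delta_mx i ord0)); rewrite bilinear_delta. Qed.

(** Nonnegativity of the form at e_i + e_j and e_i - e_j bounds X i j on both
    sides by the mean of X i i and X j j. *)
Lemma psd_entry_le (R : realType) n (X : 'M[R]_n) (M : R) :
  psd X -> (forall i, X i i <= M) -> forall i j, `|X i j| <= M.
Proof.
move=> psdX diagX i j; have [symX posX] := psdX.
have symij : X j i = X i j by rewrite -{1}symX mxE.
have expand s : 0 <= X i i + s * X i j *+ 2 + s ^+ 2 * X j j.
  have := posX (delta_mx i ord0 + s *: delta_mx j ord0).
  rewrite [(_ + _)^T]linearD /= [(_ *: _)^T]linearZ /= !mulmxDl !mulmxDr.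
  rewrite -!scalemxAl -!scalemxAr.
  have entry (A B : 'M[R]_1) : (A + B) ord0 ord0 = A ord0 ord0 + B ord0 ord0.
    by rewrite mxE.
  have entryZ a (A : 'M[R]_1) : (a *: A) ord0 ord0 = a * A ord0 ord0.
    by rewrite mxE.
  rewrite !(entry, entryZ) !bilinear_delta symij.
  by congr (0 <= _); ring.
have := expand 1; have := expand (-1).
have := diagX i; have := diagX j.
rewrite ler_norml; move=> *; apply/andP; split; lra.
Qed.

Lemma psd_rank1 (R : realType) n (u : 'cV[R]_n) : psd (u *m u^T).
Proof.
split=> [|y]; first by rewrite trmx_mul trmxK.
have -> : y^T *m (u *m u^T) *m y = (u^T *m y)^T *m (u^T *m y).
  by rewrite trmx_mul trmxK !mulmxA.
by rewrite mxE big_ord1 mxE -expr2 sqr_ge0.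
Qed.

Lemma psdZ (R : realType) n (X : 'M[R]_n) a : 0 <= a -> psd X -> psd (a *: X).
Proof.
move=> a0 [symX posX]; split=> [|y]; first by rewrite linearZ /= symX.
by rewrite -scalemxAr -scalemxAl mxE mulr_ge0.
Qed.

Lemma psd_trace_ge0 (R : realType) n (X : 'M[R]_n) : psd X -> 0 <= \tr X.
Proof. by move=> psdX; apply: sumr_ge0 => i _; exact: psd_diag_ge0. Qed.

Lemma psd_entry_le_trace (R : realType) n (X : 'M[R]_n) i j :
  psd X -> `|X i j| <= \tr X.
Proof.
move=> psdX; apply: psd_entry_le => // k.
rewrite /mxtrace (bigD1 k) //= lerDl sumr_ge0 // => l _.
exact: psd_diag_ge0.
Qed.

Lemma psd_trace0 (R : realType) n (X : 'M[R]_n) : psd X -> \tr X = 0 -> X = 0.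
Proof.
move=> psdX trX; apply/matrixP => i j; apply/eqP.
by rewrite mxE -normr_le0 -trX psd_entry_le_trace.
Qed.

(** * The bordered matrix *)

(** Nonnegativity of the bordered form at (- d^T y, y): the value - d^T y of the
    border coordinate minimises the form for fixed y. *)
Lemma bordered_schur (R : realType) n (X : 'M[R]_n) y :
  psd (bordered X) -> ((diagv X)^T *m y) ord0 ord0 ^+ 2 <= qform X y.
Proof.
case=> _ posX; set s : R := ((diagv X)^T *m y) ord0 ord0.
have := posX (col_mx (- s)%:M y).
have dy : (diagv X)^T *m y = s%:M by rewrite [LHS]mx11_scalar.
have yd : y^T *m diagv X = s%:M.
  by rewrite -[LHS]trmxK trmx_mul trmxK dy tr_scalar_mx.
rewrite tr_col_mx mul_row_block mul_row_col tr_scalar_mx !mulmxDl mulmx1.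
rewrite yd -!mulmxA dy !mulmxA -!scalar_mxM [y^T *m X *m y]mx11_scalar.
rewrite -/(qform X y) !mxE /= !mulr1n; lra.
Qed.

Lemma bordered_psd (R : realType) n (X : 'M[R]_n) :
  X^T = X -> psd (bordered X) -> psd X.
Proof.
move=> symX bX; split=> // y.
exact: le_trans (sqr_ge0 _) (bordered_schur y bX).
Qed.

Lemma psd_bordered0 (R : realType) n : psd (bordered (0 : 'M[R]_n)).
Proof.
have -> : bordered (0 : 'M[R]_n) = col_mx 1%:M 0 *m (col_mx 1%:M 0)^T.
  have d0 : diagv (0 : 'M[R]_n) = 0 by apply/colP => i; rewrite !mxE.
  by rewrite tr_col_mx mul_col_row trmx1 !trmx0 mulmx1 mulmx0 mul0mx mul0mx
    /bordered d0 trmx0.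
exact: psd_rank1.
Qed.

(** At a basis vector the Schur inequality reads X i i ^ 2 <= X i i. *)
Lemma bordered_diag_le1 (R : realType) n (X : 'M[R]_n) i :
  psd (bordered X) -> X i i <= 1.
Proof.
move=> /(bordered_schur (delta_mx i ord0)).
by rewrite /qform bilinear_delta -colE !mxE => h; nra.
Qed.

Lemma mxtrace_diagv (R : realType) n (X : 'M[R]_n) :
  \tr X = ((diagv X)^T *m (const_mx 1 : 'cV[R]_n)) ord0 ord0.
Proof. by rewrite mxE; apply: eq_bigr => i _; rewrite !mxE mulr1. Qed.

Lemma mxdot_diag (R : realType) n (X : 'M[R]_n) (u : 'cV[R]_n) :
  mxdot (diag_mx u^T) X = ((diagv X)^T *m u) ord0 ord0.
Proof.
rewrite mxE; apply: eq_bigr => i _.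
by rewrite mul_diag_mx !mxE mulrC.
Qed.

Lemma mxdotZr (R : realType) n (C X : 'M[R]_n) a :
  mxdot C (a *: X) = a * mxdot C X.
Proof. by rewrite /mxdot -scalemxAr mxtraceZ. Qed.

(** * The feasible regions *)

Section Graph.
Variables (R : realType) (V : finType) (V1 V2 : {set V}) (E : rel V).
Local Notation J := (const_mx 1 : 'M[R]_#|V|).
Local Notation bfeas := (bordered_feasible (R := R) V1 V2 E).
Local Notation tfeas := (trace_feasible (R := R) V1 V2 E).
Local Notation f := (fvec R V1 V2).

Lemma edge_zero_closed : closed [set X : 'M[R]_#|V| | edge_zero E X].
Proof.
apply: closed_forall => x; apply: closed_forall => y.
apply: closed_forall => _.
by apply: closed_preimage_eq; [exact: coord_continuous | exact: cst_continuous].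
Qed.

Lemma mxdot_eq_closed n (C : 'M[R]_n) c : closed [set X | mxdot C X = c].
Proof.
by apply: closed_preimage_eq; [exact: mxdot_continuous | exact: cst_continuous].
Qed.

Lemma bordered_feasible_closed : closed bfeas.
Proof.
have -> : bfeas =
    [set X : 'M[R]_#|V| | forall ij, X ij.2 ij.1 = X ij.1 ij.2] `&`
    [set X | psd (bordered X)] `&` [set X | edge_zero E X] `&`
    [set X | mxdot (f *m f^T) X = 0].
  apply/seteqP; split=> X /=.
    case=> symX *; do 3 (split=> //).
    by move=> ij; rewrite -{1}symX mxE.
  case=> [[[symX psdX] eX] fX]; split=> //.
  by apply/matrixP => i j; rewrite mxE (symX (i, j)).
apply: closedI; last exact: mxdot_eq_closed.
apply: closedI; last exact: edge_zero_closed.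
apply: closedI; last by apply: psd_closed; exact: bordered_continuous.
apply: closed_forall => ij.
by apply: closed_preimage_eq; exact: coord_continuous.
Qed.

Lemma trace_feasible_closed : closed tfeas.
Proof.
have -> : tfeas = [set X | psd X] `&` [set X | mxdot 1%:M X = 1] `&`
    [set X | edge_zero E X] `&` [set X | mxdot (f *m f^T) X = 0] `&`
    [set X | mxdot (diag_mx f^T) X = 0].
  apply/seteqP; split=> X /=; rewrite /mxdot mul1mx; first by case.
  by case=> [[[[? ?] ?] ?] ?].
apply: closedI; last exact: mxdot_eq_closed.
apply: closedI; last exact: mxdot_eq_closed.
apply: closedI; last exact: edge_zero_closed.
apply: closedI; last exact: mxdot_eq_closed.
by apply: psd_closed; exact: coord_continuous.
Qed.

Lemma bordered_attained (C : 'M[R]_#|V|) :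
  exists2 X, bfeas X & maximize (mxdot C) bfeas = mxdot C X /\
    forall Y, bfeas Y -> mxdot C Y <= mxdot C X.
Proof.
apply: (@maximize_attained _ _ _ _ 1).
- exact: mxdot_continuous.
- exact: bordered_feasible_closed.
- move=> X [symX bX _ _]; apply: psd_entry_le; first exact: bordered_psd.
  by move=> i; exact: bordered_diag_le1.
- exists 0; split=> [||x y _|].
  + exact: trmx0.
  + exact: psd_bordered0.
  + by rewrite mxE.
  + by rewrite /mxdot mulmx0 mxtrace0.
Qed.

Lemma trace_attained (C : 'M[R]_#|V|) : tfeas !=set0 ->
  exists2 X, tfeas X & maximize (mxdot C) tfeas = mxdot C X /\
    forall Y, tfeas Y -> mxdot C Y <= mxdot C X.
Proof.
apply: (@maximize_attained _ _ _ _ 1).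
- exact: mxdot_continuous.
- exact: trace_feasible_closed.
- by move=> X [psdX <- _ _ _] i j; exact: psd_entry_le_trace.
Qed.

(** * Comparison of the programs *)

(** Entrywise, 1 - f_i f_j is 2 across the bipartition and 0 within a side, so
    that C = (J - f f^T) / 4. *)
Lemma mxdot_Cmx X : is_bipartite V1 V2 E -> mxdot (f *m f^T) X = 0 ->
  mxdot (Cmx R V1 V2) X = 4^-1 * mxdot J X.
Proof.
case=> cover disj _ _ fX.
suff -> : Cmx R V1 V2 = 4^-1 *: (J - f *m f^T).
  rewrite /mxdot -scalemxAl mxtraceZ mulmxBl raddfB /=.
  by rewrite -/(mxdot _ _) -/(mxdot _ X) fX subr0.
apply/matrixP => i j; rewrite !mxE big_ord1 !mxE.
have side x : (x \in V2) = ~~ (x \in V1).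
  move/finset.setP/(_ x): cover; move/finset.setP/(_ x): disj; rewrite !inE.
  by case: (x \in V1); case: (x \in V2).
rewrite /= !side; case: (_ \in V1); case: (_ \in V1) => /=; lra.
Qed.

(** The Schur inequality at the all-ones vector. *)
Lemma bordered_trace_sqr X : bfeas X -> (\tr X) ^+ 2 <= mxdot J X.
Proof.
case=> _ bX _ _; rewrite const_mx1_rank1 mxdot_rank1 mxtrace_diagv.
exact: bordered_schur.
Qed.

(** The linear constraints scale; the constraint d^T f = 0 of the trace programs
    comes from the Schur inequality (d^T f)^2 <= f^T X f = 0. *)
Lemma bordered_normalize X : bfeas X -> 0 < \tr X -> tfeas ((\tr X)^-1 *: X).
Proof.
case=> symX bX eX fX trX; split.
- by apply: psdZ; [rewrite invr_ge0 ltW | exact: bordered_psd].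
- by rewrite mxtraceZ mulVf // gt_eqF.
- by move=> x y /eX h; rewrite mxE h mulr0.
- by rewrite mxdotZr fX mulr0.
- rewrite mxdotZr mxdot_diag.
  have := bordered_schur f bX; rewrite -mxdot_rank1 fX => h.
  have /eqP -> : ((diagv X)^T *m f) ord0 ord0 == 0.
    by rewrite -sqrf_eq0 eq_le h sqr_ge0.
  by rewrite mulr0.
Qed.

Lemma theta_ge0 : 0 <= theta_bal R V1 V2 E.
Proof.
have [tn0|/set0P/negP/negPn/eqP t0] := pselect (tfeas !=set0).
  have [X [[_ posX] _ _ _ _] [eqX _]] := trace_attained J tn0.
  rewrite /theta_bal eqX const_mx1_rank1 mxdot_rank1; exact: posX.
by rewrite /theta_bal t0 maximize_set0.
Qed.

Lemma theta_ge X : bfeas X -> 0 < \tr X ->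
  (\tr X)^-1 * mxdot J X <= theta_bal R V1 V2 E.
Proof.
move=> bX trX; have tX := bordered_normalize bX trX.
have [|Y _ [eqY maxY]] := trace_attained J; first by exists ((\tr X)^-1 *: X).
by rewrite /theta_bal eqY -mxdotZr maxY.
Qed.

Lemma h_eq_theta : is_bipartite V1 V2 E ->
  h_bal1 R V1 V2 E = 4^-1 * theta_bal R V1 V2 E.
Proof.
move=> hG.
have [tn0|/set0P/negP/negPn/eqP t0] := pselect (tfeas !=set0); last first.
  by rewrite /theta_bal /h_bal1 t0 !maximize_set0 mulr0.
have [X tX [eqX maxX]] := trace_attained J tn0.
have CJ Y : tfeas Y -> mxdot (Cmx R V1 V2) Y = 4^-1 * mxdot J Y.
  by case=> _ _ _ fY _; exact: mxdot_Cmx.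
rewrite /theta_bal eqX -CJ //; apply: maximize_eq => // Y tY.
by rewrite !CJ // ler_pM2l ?maxX // invr_gt0.
Qed.

End Graph.

Theorem proposition6p4 (R : realType) (V : finType) (V1 V2 : {set V})
    (E : rel V) (hG : is_bipartite V1 V2 E) :
  let las := las_bal1 R V1 V2 E in
  let g := g_bal1 R V1 V2 E in
  let h := h_bal1 R V1 V2 E in
  let theta := theta_bal R V1 V2 E in
  [/\ 4^-1 * las <= 2^-1 * Num.sqrt g,
      2^-1 * Num.sqrt g <= h,
      h = 4^-1 * theta &
      (2^-1 * Num.sqrt g = 4^-1 * theta <-> las = theta)].
Proof.
move=> las g h theta.
have [X bX [lasE maxX]] := bordered_attained V1 V2 E (1%:M : 'M[R]_#|V|).
have [Y bY [gE maxY]] := bordered_attained V1 V2 E (Cmx R V1 V2).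
have trE Z : mxdot (1%:M : 'M[R]_#|V|) Z = \tr Z by rewrite /mxdot mul1mx.
have CJ Z : bordered_feasible V1 V2 E Z ->
    mxdot (Cmx R V1 V2) Z = 4^-1 * mxdot (const_mx 1) Z.
  by case=> _ _ _ fZ; exact: mxdot_Cmx hG fZ.
have {}lasE : las = \tr X by rewrite -trE -lasE.
have {}gE : g = 4^-1 * mxdot (const_mx 1) Y by rewrite -CJ // -gE.
have trle Z : bordered_feasible V1 V2 E Z -> (\tr Z) ^+ 2 <= 4 * g.
  move=> bZ; apply: le_trans (bordered_trace_sqr bZ) _.
  have := maxY _ bZ; rewrite !CJ // -gE; lra.
have g0 : 0 <= g.
  by have := trle _ bY; have := sqr_ge0 (\tr Y); lra.
pose s := Num.sqrt g.
have s0 : 0 <= s by exact: sqrtr_ge0.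
have sqs : s ^+ 2 = g by exact: sqr_sqrtr.
have trles Z : bordered_feasible V1 V2 E Z -> \tr Z <= 2 * s.
  move=> /trle; rewrite -sqs => h2; rewrite leNgt; apply/negP => h1; nra.
have psdY : psd Y by case: bY => symY bY _ _; exact: bordered_psd.
have trY0 : 0 <= \tr Y := psd_trace_ge0 psdY.
have theta0 : 0 <= theta := theta_ge0 R V1 V2 E.
(* A trace-zero Y cannot be normalised, but it vanishes, and then g = 0. *)
have scaleY : 4 * s ^+ 2 <= theta * \tr Y.
  have [trY|trY] := eqVneq (\tr Y) 0.
    by rewrite trY sqs gE (psd_trace0 psdY trY) /mxdot mulmx0 mxtrace0 !mulr0.
  have trYgt0 : 0 < \tr Y by rewrite lt_def trY.
  have := theta_ge bY trYgt0; rewrite ler_pdivrMl // mulrC => thY.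
  by apply: le_trans thY; rewrite sqs gE; lra.
have lass := trles _ bX; have sY := trles _ bY; rewrite -lasE in lass.
have trYX : \tr Y <= las by rewrite lasE -!trE; exact: maxX.
(* Otherwise s > 0 and theta * Tr Y <= theta * 2 s < 4 s ^ 2. *)
have stheta : 2 * s <= theta by rewrite leNgt; apply/negP => thetas; nra.
split.
- by change (4^-1 * las <= 2^-1 * s); lra.
- by rewrite /h h_eq_theta //; change (2^-1 * s <= 4^-1 * theta); lra.
- exact: h_eq_theta.
change (2^-1 * s = 4^-1 * theta <-> las = theta).
split=> [eqs|eqlas]; last by lra.
have thetaE : theta = 2 * s by lra.
apply/eqP; rewrite eq_le; apply/andP; split; first by lra.
suff : 2 * s <= \tr Y by lra.
(* If Tr Y < 2 s, then s > 0 because Tr Y >= 0, and [scaleY] fails. *)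
by rewrite leNgt; apply/negP => lts; rewrite thetaE in scaleY; nra.
Qed.
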